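(* For positive integers $M$, as $M\to\infty$, $$\frac1{2M+1}\sum_{N=-M}^M\|N\|_F=\frac15\,\frac{\log M}{\log\frac{1+\sqrt5}2}+\mathcal O(1).$$
   Context: Fibonacci numbers: $F_0=1$, $F_1=2$, $F_n=F_{n-1}+F_{n-2}$. For words $x=x_1\cdots x_n$ over $\mathbb Z$, $x$ represents the integer $\sum_{j=1}^n x_jF_{n-j}$; $x\sim_F y$ means $x$ and $y$ represent the same integer; $\|x\|=\sum_j|x_j|$. $x$ is an $F$-expansion of minimal weight if there is no $y\in\mathbb Z^*$ with $x\sim_F y$ and $\|y\|<\|x\|$. For $N\in\mathbb Z$, $\|N\|_F$ is the weight $\|x\|$ of an $F$-expansion of minimal weight $x$ representing $N$ (i.e. the minimum of $\|x\|$ over all $x\in\mathbb Z^*$ representing $N$). *)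

(* Defs.v *)
From HB Require Import structures.
From mathcomp Require Import all_boot all_order all_algebra.
From mathcomp Require Import boolp.
Set Implicit Arguments.
Unset Strict Implicit.
Unset Printing Implicit Defensive.
Import Order.TTheory GRing.Theory Num.Theory.
Local Open Scope ring_scope.

(* The indexing starts at 1, 2: F_0 = 1, F_1 = 2, F_2 = 3, F_3 = 5, ... *)
Fixpoint fibF (n : nat) : nat :=
  match n with
  | 0 => 1
  | 1 => 2
  | (n'.+1 as m).+1 => (fibF m + fibF n')%N
  end.

(* x_1 ... x_n represents \sum_(1 <= j <= n) x_j F_(n-j); the letter x_(j+1)
   is x`_j, so the last letter has weight F_0. *)
Definition Fval (x : seq int) : int :=
  \sum_(j < size x) x`_j * (fibF (size x - j.+1))%:Z.

Definition Feq (x y : seq int) : Prop := Fval x = Fval y.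

Definition wt (x : seq int) : nat := (\sum_(a <- x) `|a|)%N.

Definition Fminimal (x : seq int) : Prop :=
  ~ exists y : seq int, Feq x y /\ (wt y < wt x)%N.

Definition is_Fweight (N : int) (w : nat) : Prop :=
  exists x : seq int, Fval x = N /\ wt x = w.

Lemma Fweight_ex (N : int) : exists w : nat, `[< is_Fweight N w >].
Proof.
exists (wt [:: N]); apply/asboolP; exists [:: N]; split=> //.
by rewrite /Fval big_ord_recl big_ord0 /= mulr1 addr0.
Qed.

Definition Fnorm (N : int) : nat := ex_minn (Fweight_ex N).

Lemma Fnorm_minimal (x : seq int) : Fminimal x -> Fnorm (Fval x) = wt x.
Proof.
move=> xmin; rewrite /Fnorm; case: ex_minnP => w /asboolP[y [yx <-]] wmin.
apply/eqP; rewrite eqn_leq wmin /=; last by apply/asboolP; exists x.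
by rewrite leqNgt; apply/negP => lt_yx; apply: xmin; exists y.
Qed.

Lemma Fminimal_ex (N : int) :
  exists x : seq int, [/\ Fval x = N, Fminimal x & wt x = Fnorm N].
Proof.
rewrite /Fnorm; case: ex_minnP => w /asboolP[x [xN <-]] wmin.
exists x; split=> // -[y [xy]]; rewrite ltnNge wmin //.
by apply/asboolP; exists y; rewrite -xN.
Qed.

(* Main.v *)
Require Import Defs.
From mathcomp Require Import all_boot all_order all_algebra.
From mathcomp Require Import all_classical all_reals all_analysis.
From mathcomp Require Import zify ring lra.
Import Order.TTheory GRing.Theory Num.Theory.
Import numFieldNormedType.Exports.
Local Open Scope classical_set_scope.
Local Open Scope ring_scope.

(* A minimal-weight expansion is a shortest list of signed terms +-F_k with the
   given sum.  Two terms of opposite sign at distance <= 2, or of equal sign at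
   distance 1, merge into at most one term; the remaining close pairs are
   rewritten without changing the weight by
     2 F_k = F_(k+2) - F_(k-1),   F_(k+2) + F_k = F_(k+3) - F_(k-1),
     F_(k+3) + F_k = F_(k+4) - F_(k+1),
   each of which increases the sum of the squared positions.  Maximising that
   sum over the shortest lists in a large enough window of positions yields an
   expansion in which equal signs are >= 4 apart and opposite signs >= 3 apart.
   Such expansions with leading term +F_k represent exactly the integers of
   (h_k, h_(k+1)], where h_k = F_(k-1) + F_(k-5) + ..., so that
   ||N|| = 1 + ||N - F_k|| on this interval.  Hence T_k = ||1|| + ... + ||h_k||
   satisfies T_(k+1) = T_k + T_(k-2) + T_(k-3) + (h_(k+1) - h_k), which gives
   5 T_k = k h_k + O(F_k); cutting the sum at an arbitrary M in the same way
   costs another O(M). *)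

(** * Signed-term lists in place of words *)

Arguments fibF : simpl never.

Lemma fibFSS k : fibF k.+2 = (fibF k.+1 + fibF k)%N.
Proof. by []. Qed.

Lemma fibF_mono k : (fibF k <= fibF k.+1)%N.
Proof. by case: k => [|k] //; rewrite fibFSS leq_addr. Qed.

(* A pair (b, k) stands for the signed term (-1)^b F_k, so that a word of weight
   w becomes, up to order, a list of w signed terms. *)
Definition termval (t : bool * nat) : int :=
  if t.1 then - (fibF t.2)%:Z else (fibF t.2)%:Z.

Definition tsum (s : seq (bool * nat)) : int := \sum_(t <- s) termval t.

Lemma tsum_nil : tsum [::] = 0.
Proof. exact: big_nil. Qed.

Lemma tsum_cons t s : tsum (t :: s) = termval t + tsum s.
Proof. exact: big_cons. Qed.

Lemma tsum_cat s1 s2 : tsum (s1 ++ s2) = tsum s1 + tsum s2.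
Proof. exact: big_cat. Qed.

Lemma Fval_cons a x : Fval (a :: x) = a * (fibF (size x))%:Z + Fval x.
Proof. by rewrite /Fval big_ord_recl /= subn1. Qed.

Lemma word_terms x : exists2 s, tsum s = Fval x & size s = wt x.
Proof.
elim: x => [|a x [s sx sw]].
  by exists [::]; rewrite ?tsum_nil /Fval /wt ?big_ord0 ?big_nil.
exists (nseq `|a| (a < 0, size x) ++ s).
  rewrite tsum_cat Fval_cons sx; congr (_ + _).
  rewrite /tsum big_nseq iter_addr_0 -mulr_natl natz /termval /=.
  by case: ltrP => a0; lia.
by rewrite size_cat size_nseq sw /wt big_cons.
Qed.

Lemma sum_delta n p (c : int) : (p < n)%N -> \sum_(i < n) (i == p :> nat)%:Z * c = c.
Proof.
move=> pn; rewrite (bigD1 (Ordinal pn)) //= eqxx mul1r big1 ?addr0 // => i.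
by rewrite -val_eqE /= => /negbTE ->; rewrite mul0r.
Qed.

(** Terms at one position are added into one digit; cancellation can only lower the weight, hence
    the inequality. *)
Lemma terms_digits s n : all (fun t => t.2 < n)%N s ->
  exists f : nat -> int, \sum_(i < n) f i * (fibF i)%:Z = tsum s /\
    (\sum_(i < n) `|f i| <= size s)%N.
Proof.
elim: s => [_|[b p] s IH /= /andP[pn /IH[f [fs fw]]]].
  exists (fun=> 0); rewrite tsum_nil !big1 // => i _; exact: mul0r.
pose c : int := if b then -1 else 1.
exists (fun i => f i + (i == p)%:Z * c); split.
  rewrite tsum_cons -fs addrC.
  under eq_bigr do rewrite mulrDl.
  rewrite big_split /=; congr (_ + _).
  rewrite -(sum_delta n p (termval (b, p))) //; apply: eq_bigr => i _.
  by case: eqP => [->|_]; rewrite /termval /c /=; case: b {c}; lia.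
have -> : (size s).+1 = (size s + \sum_(i < n) (i == p :> nat))%N.
  rewrite (bigD1 (Ordinal pn)) //= eqxx big1 ?addn0 ?addn1 // => i.
  by rewrite -val_eqE /= => /negbTE ->.
apply: leq_trans (leq_add fw (leqnn _)).
rewrite -big_split /=; apply: leq_sum => i _.
by rewrite /c; case: b {c}; case: eqP => _; lia.
Qed.

Lemma terms_word s : exists2 x, Fval x = tsum s & (wt x <= size s)%N.
Proof.
pose n := (\max_(t <- s) t.2).+1.
have sn : all (fun t => t.2 < n)%N s.
  by apply/allP => t ts; rewrite ltnS (big_rem t ts) leq_maxl.
have [f [fs fw]] := terms_digits s n sn.
exists (mkseq (fun j => f (n - j.+1)%N) n).
  rewrite -fs /Fval size_mkseq (reindex_inj rev_ord_inj) /=.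
  apply: eq_bigr => i _; rewrite nth_mkseq; last by have := ltn_ord i; lia.
  by congr (f _ * (fibF _)%:Z); have := ltn_ord i; lia.
apply: leq_trans fw; rewrite /wt big_map -[X in iota _ X]subn0 -/(index_iota 0 n) big_mkord.
rewrite (reindex_inj rev_ord_inj) /=; apply: leq_sum => i _.
by rewrite subnSK // subKn // ltnW.
Qed.

Lemma Fnorm_le_size s : (Fnorm (tsum s) <= size s)%N.
Proof.
have [x <- xs] := terms_word s; rewrite /Fnorm; case: ex_minnP => w _ wmin.
by apply: leq_trans xs; apply: wmin; apply/asboolP; exists x.
Qed.

Lemma Fnorm_terms N : exists2 s, tsum s = N & size s = Fnorm N.
Proof.
rewrite /Fnorm; case: ex_minnP => w /asboolP[x [<- <-]] _.
exact: word_terms.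
Qed.

Lemma Fnorm0 : Fnorm 0 = 0%N.
Proof. by apply/eqP; rewrite -leqn0; have := Fnorm_le_size [::]; rewrite tsum_nil. Qed.

Definition termneg (t : bool * nat) := (~~ t.1, t.2).

Lemma termvalN t : termval (termneg t) = - termval t.
Proof. by case: t => [[] k]; rewrite /termval //= opprK. Qed.

Lemma tsumN s : tsum (map termneg s) = - tsum s.
Proof.
elim: s => [|t s IH]; first by rewrite tsum_nil oppr0.
by rewrite /= !tsum_cons termvalN IH opprD.
Qed.

Lemma FnormN N : Fnorm (- N) = Fnorm N.
Proof.
have le M : (Fnorm (- M) <= Fnorm M)%N.
  by have [s <- <-] := Fnorm_terms M; rewrite -tsumN -(size_map termneg) Fnorm_le_size.
by apply/eqP; rewrite eqn_leq le -{1}(opprK N) le.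
Qed.

(** * Extreme values of separated expansions *)

(* [hmax k] = F_(k-1) + F_(k-5) + F_(k-9) + ... is the largest integer whose
   separated expansion only uses positions below k. *)
Fixpoint hmax (k : nat) : nat :=
  match k with
  | k'.+4 => (fibF k'.+3 + hmax k')%N
  | _ => k
  end.

Arguments hmax : simpl never.

Lemma hmax4 k : hmax k.+4 = (fibF k.+3 + hmax k)%N.
Proof. by []. Qed.

Lemma nat_ind4 (P : nat -> Prop) : P 0%N -> P 1%N -> P 2 -> P 3 ->
  (forall k, P k -> P k.+4) -> forall k, P k.
Proof. by move=> P0 P1 P2 P3 PS; elim/ltn_ind => -[|[|[|[|k]]]] // IH; apply/PS/IH; lia. Qed.

Lemma hmax_add2 k : (hmax k + hmax k.+2).+1 = fibF k.+2.
Proof.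
elim/nat_ind4: k => // k IH.
by rewrite !hmax4; have := fibFSS k.+4; have := fibFSS k.+2; have := fibFSS k.+3; lia.
Qed.

(** The least separated sum led by [+F_k] is [F_k - hmax (k - 2)]; it equals [hmax k + 1], so the
    intervals of consecutive leading positions abut. *)
Lemma fibF_hmax k : fibF k = (hmax k + hmax (k - 2)).+1.
Proof. by case: k => [|[|k]] //; rewrite -hmax_add2 subSS subSS subn0 addnC. Qed.

Lemma hmaxS k : hmax k.+1 = (fibF k + hmax (k - 3))%N.
Proof. by case: k => [|[|[|k]]] //; rewrite hmax4 !subSS subn0. Qed.

Lemma hmax_lt k : (hmax k < hmax k.+1)%N.
Proof. by rewrite hmaxS fibF_hmax; lia. Qed.

Lemma hmax_mono j k : (j <= k)%N -> (hmax j <= hmax k)%N.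
Proof. by apply: (homo_leq (fun=> leqnn _) leq_trans) => i; apply/ltnW/hmax_lt. Qed.

Lemma leq_hmax k : (k <= hmax k)%N.
Proof. by elim: k => // k IH; apply: leq_ltn_trans (hmax_lt k). Qed.

(** * Separated and nearly separated lists *)

Definition sep (t u : bool * nat) := (u.2 + 3 + (t.1 == u.1) <= t.2)%N.

Definition sgv (b : bool) (N : int) : int := if b then - N else N.

(** By induction, a tail of the same sign as [t] adds at most [hmax (t.2 - 3)], and one of opposite
    sign takes away at most [hmax (t.2 - 2)]; [hmaxS] and [fibF_hmax] turn these into the two
    bounds. *)
Lemma separated_bound t s : pairwise sep (t :: s) ->
  (hmax t.2)%:Z < sgv t.1 (tsum (t :: s)) <= (hmax t.2.+1)%:Z.
Proof.
elim: s t => [|u s IH] t.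
  move=> _; rewrite tsum_cons tsum_nil addr0 hmaxS.
  have := fibF_hmax t.2; case: t => -[] k; rewrite /sgv /termval /=; lia.
rewrite pairwise_cons => /andP[/= /andP[tu _] /IH].
rewrite (tsum_cons t).
have hF := fibF_hmax t.2; rewrite (hmaxS t.2); have hu := hmax_lt u.2.
have: (hmax u.2.+1 <= hmax (t.2 - (2 + (t.1 == u.1))))%N.
  by apply: hmax_mono; move: tu; rewrite /sep; lia.
have: (hmax (t.2 - 3) <= hmax (t.2 - 2))%N by apply: hmax_mono; lia.
move: (tsum _) hF hu tu; rewrite /sep /sgv /termval.
by case: t u {IH} => -[] k [] [] l; rewrite /= ?addn0 ?addn1; lia.
Qed.

(* Same-sign pairs close to the top of the window cannot be rewritten inside it. *)
Definition nsep n (t u : bool * nat) :=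
  sep t u || [&& t.1 == u.1, u.2 <= t.2 & n <= t.2.+1]%N.

Lemma nsep_sep n t s : (t.2.+1 < n)%N -> pairwise (nsep n) (t :: s) ->
  pairwise sep (t :: s).
Proof.
move=> tn ts; have: all (fun u => u.2.+1 < n)%N (t :: s).
  rewrite /= tn; apply/allP => u us; move: ts; rewrite pairwise_cons.
  by case/andP => /allP /(_ u us) + _; rewrite /nsep /sep; lia.
move=> sn; apply: (sub_in_pairwise _ sn ts) => u v.
rewrite -!topredE /= /nsep; case: sep => //= un _; lia.
Qed.

(** Only the lower bound survives: a tail of equal sign pushes the sum further out, and a tail of
    opposite sign starts low enough in the window to be truly separated. *)
Lemma nsep_pos n t s : pairwise (nsep n) (t :: s) -> all (fun u => u.2 <= n)%N (t :: s) ->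
  (hmax t.2)%:Z < sgv t.1 (tsum (t :: s)).
Proof.
elim: s t => [|u s IH] t st sn; first by case/andP: (separated_bound t [::] isT).
move: (st); rewrite pairwise_cons => /andP[/= /andP[tu _] us].
have hF := fibF_hmax t.2; rewrite (tsum_cons t).
have [tu1|tu1] := eqVneq t.1 u.1.
  have := IH u us; rewrite /= in sn *; case/andP: sn => _ -> /(_ isT).
  move: (tsum _) hF; rewrite -tu1 /sgv /termval; case: t.1 => N; lia.
have {}tu : sep t u by move: tu; rewrite /nsep (negbTE tu1) orbF.
have us' : pairwise sep (u :: s).
  by apply: nsep_sep us; case/andP: sn => + _; move: tu; rewrite /sep; lia.
have := separated_bound u s us'.
have: (hmax u.2.+1 <= hmax (t.2 - 2))%N.
  by apply: hmax_mono; move: tu; rewrite /sep; lia.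
move: (tsum _) hF tu1; rewrite /sgv /termval.
by case: t u {IH tu us us' st sn} => -[] k [] [] l; rewrite /=; lia.
Qed.

(** * Existence of separated shortest expansions *)

Definition pot (s : seq (bool * nat)) := (\sum_(t <- s) t.2 * t.2)%N.

Definition inwin n (s : seq (bool * nat)) := all (fun t => t.2 <= n)%N s.

(** Only the second alternative asks for the window: a shorter list contradicts minimality wherever
    its terms lie. *)
Definition improves n (q p : seq (bool * nat)) :=
  (size q < size p)%N || [&& size q == size p, inwin n q & (pot p < pot q)%N].

Lemma rewrite_pair n t u : (u.2 <= t.2)%N ->
  nsep n t u \/ exists2 q, tsum q = termval t + termval u & improves n q [:: t; u].
Proof.
case: t u => b m [b' k] /= /subnK <-; move: (m - k)%N => d {m}.
case: (boolP (nsep n _ _)) => [|nse]; [by left | right].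
have F0 : fibF 0 = 1%N by []. have F1 : fibF 1 = 2%N by [].
pose FS := fibFSS.
have tsum1 t : tsum [:: t] = termval t by rewrite tsum_cons tsum_nil addr0.
have tsum2 t u : tsum [:: t; u] = termval t + termval u by rewrite tsum_cons tsum1.
have pot2 t u : pot [:: t; u] = (t.2 * t.2 + u.2 * u.2)%N.
  by rewrite /pot big_cons big_seq1.
move: nse; rewrite /nsep /sep /=; have [<-{b'}|bb'] := eqVneq b b'.
  (* For equal signs [dn] puts the upper position at most at [n - 2], and the rewritings below raise
     it by at most 2, so they stay in the window. *)
  case: d => [|[|[|[|d]]]] //= dn; last by exfalso; lia.
  - case: k dn => [|k] dn.
      (* At the bottom [2 F_0 = F_1], which even shortens the list. *)
      exists [:: (b, 1%N)]; rewrite // tsum1 /termval /= add0n; case: b {dn} => /=; lia.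
    exists [:: (b, k.+3); (~~ b, k)].
      by rewrite tsum2 /termval /= add0n; have := FS k; have := FS k.+1; case: b {dn} => /=; lia.
    by rewrite /improves !pot2 /=; nia.
  - exists [:: (b, k.+2)] => //.
    by rewrite tsum1 /termval /= add1n; have := FS k; case: b {dn} => /=; lia.
  (* At [k = 0] the truncated [k.-1] is correct: the recurrence extended downwards gives
     [F_(-1) = 1 = F_0]. *)
  - exists [:: (b, k.+3); (~~ b, k.-1)].
      rewrite tsum2 /termval /= add2n; have := FS k; have := FS k.+1.
      by case: k {dn} => [|k] /=; [|have := FS k]; case: b => /=; lia.
    by rewrite /improves !pot2 /=; case: k dn => [|k] /=; nia.
  - exists [:: (b, k.+4); (~~ b, k.+1)].
      rewrite tsum2 /termval /= !addSn add0n.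
      by have := FS k; have := FS k.+1; have := FS k.+2; case: b {dn} => /=; lia.
    by rewrite /improves !pot2 /=; nia.
case: d => [|[|[|d]]] dn; last by exfalso; lia.
- by exists [::]; rewrite // tsum_nil /termval /= add0n; case: b b' bb' {dn} => -[] // _ /=; lia.
- exists [:: (b, k.-1)]; rewrite // tsum1 /termval /= add1n.
  by case: k {dn} => [|k] /=; [|have := FS k]; case: b b' bb' => -[] // _ /=; lia.
- exists [:: (b, k.+1)]; rewrite // tsum1 /termval /= add2n.
  by have := FS k; case: b b' bb' {dn} => -[] // _ /=; lia.
Qed.

Lemma extremal_terms N n s0 : tsum s0 = N -> size s0 = Fnorm N -> inwin n s0 ->
  exists s, [/\ tsum s = N, size s = Fnorm N, inwin n s &
    forall s', tsum s' = N -> size s' = Fnorm N -> inwin n s' -> (pot s' <= pot s)%N].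
Proof.
move=> s0N s0w s0n.
pose Q m := `[< exists s, [/\ tsum s = N, size s = Fnorm N, inwin n s & pot s = m] >].
have Qex : exists m, Q m by exists (pot s0); apply/asboolP; exists s0.
have Qle m : Q m -> (m <= Fnorm N * (n * n))%N.
  move=> /asboolP[s [_ <- + <-]]; rewrite /pot.
  elim: s => [|t s IH] /=; first by rewrite big_nil.
  by rewrite big_cons mulSn => /andP[tn /IH]; apply: leq_add; apply: leq_mul.
case: (ex_maxnP Qex Qle) => m /asboolP[s [sN sw sn <-]] smax.
by exists s; split=> // s' *; apply: smax; apply/asboolP; exists s'.
Qed.

Lemma tsum_perm s1 s2 : perm_eq s1 s2 -> tsum s1 = tsum s2.
Proof. exact: perm_big. Qed.

(** A permutation brings any two entries to the front, so the pair rewriting also applies to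
    non-adjacent terms; [r] holds the entries already passed. *)
Lemma pairwise_perm (T : eqType) (leT e : rel T) r s :
  transitive leT -> sorted leT s ->
  (forall t u s', perm_eq (r ++ s) (t :: u :: s') -> leT t u -> e t u) ->
  pairwise e s.
Proof.
move=> leT_tr; elim: s r => //= t s IH r ts He; apply/andP; split; last first.
  apply: (IH (rcons r t)) => [|u v s']; first exact: path_sorted ts.
  by rewrite cat_rcons; apply: He.
apply/allP => u us; apply: (He _ _ (r ++ rem u s)).
  rewrite -cat1s perm_catCA /= perm_cons.
  apply: (@perm_trans _ (r ++ u :: rem u s)); first by rewrite perm_cat2l perm_to_rem.
  by rewrite -cat1s perm_catCA.
by have /allP := order_path_min leT_tr ts; apply.
Qed.

Lemma separated_terms N : exists s, [/\ tsum s = N, size s = Fnorm N & pairwise sep s].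
Proof.
have [s0 s0N s0w] := Fnorm_terms N.
(* The maximum makes room for [s0]; the summand [|N|] keeps the leading term of the final list away
   from the top of the window. *)
pose n := (`|N| + \max_(t <- s0) t.2).+1.
have s0n : inwin n s0.
  apply/allP => t ts; rewrite /n (big_rem t ts) /=.
  by apply: leqW; apply: leq_trans (leq_addl _ _); rewrite leq_maxl.
have [s1 [s1N s1w s1n s1max]] := extremal_terms N n s0 s0N s0w s0n.
pose leT (t u : bool * nat) := (u.2 <= t.2)%N.
have leT_tr : transitive leT by move=> u t v; rewrite /leT => ut vu; apply: leq_trans ut.
have leT_tot : total leT by move=> t u; apply: leq_total.
pose s := sort leT s1.
have ss1 : perm_eq s1 s by rewrite perm_sym; apply/permEl/perm_sort.
have sN : tsum s = N by rewrite -(tsum_perm _ _ ss1).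
have sw : size s = Fnorm N by rewrite size_sort.
have sn : inwin n s by rewrite /inwin -(perm_all _ ss1).
exists s; split=> //.
have {s1N s1w s1n} ns : pairwise (nsep n) s.
  apply: (pairwise_perm _ leT _ [::]) => //; first exact: sort_sorted.
  move=> t u s' /= ps tu; case: (rewrite_pair n t u tu) => // -[q qv qi].
  have : tsum (q ++ s') = N by rewrite tsum_cat qv -sN (tsum_perm _ _ ps) !tsum_cons addrA.
  case/orP: qi => [qs|/and3P[/eqP qs qn qp]] qN.
    have := Fnorm_le_size (q ++ s'); rewrite qN -sw (perm_size ps) size_cat /=.
    by move: qs; rewrite /=; lia.
  have: (pot (q ++ s') <= pot s1)%N.
    apply: s1max => //; first by rewrite size_cat qs -sw (perm_size ps).
    rewrite /inwin all_cat; apply/andP; split=> //.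
    by move: sn; rewrite /inwin (perm_all _ ps) /= => /and3P[].
  have -> : pot s1 = pot ([:: t; u] ++ s') by apply: perm_big; apply: perm_trans ss1 ps.
  by rewrite /pot !big_cat /=; move: qp; rewrite /pot; lia.
case: s sN ns sn {sw ss1} => // t s tsN ns sn.
(* A leading position of at least [n - 1] would force [|N| > hmax (n - 1) >= n - 1 >= |N|]. *)
apply: (nsep_sep n) => //; rewrite ltnNge; apply/negP => nt.
have := nsep_pos n t s ns sn; rewrite tsN.
have : (hmax n.-1 <= hmax t.2)%N by apply: hmax_mono; lia.
have := leq_hmax n.-1; rewrite /n /= /sgv; case: t.1; lia.
Qed.

(** The intervals for different leading positions are disjoint, so a separated shortest expansion of
    [N] must start with [+F_k]; deleting that term gives the nontrivial inequality. *)
Lemma Fnorm_step k (N : int) : (hmax k)%:Z < N <= (hmax k.+1)%:Z ->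
  Fnorm N = (Fnorm (N - (fibF k)%:Z)).+1.
Proof.
move=> /andP[kN Nk]; apply/eqP; rewrite eqn_leq; apply/andP; split.
  have [s sN <-] := Fnorm_terms (N - (fibF k)%:Z).
  have -> : N = tsum ((false, k) :: s) by rewrite tsum_cons sN /termval /=; lia.
  exact: Fnorm_le_size.
have [[|t s] [sN <- ss]] := separated_terms N; first by rewrite tsum_nil in sN; lia.
have := separated_bound t s ss; rewrite sN.
case: t sN {ss} => -[] j sN; rewrite /sgv /=; first by lia.
have [jk|kj|<-] := ltngtP j k.
- by have := hmax_mono _ _ jk; lia.
- by have := hmax_mono _ _ kj; lia.
have -> : N - (fibF j)%:Z = tsum s by rewrite -sN tsum_cons /termval /=; lia.
by rewrite ltnS Fnorm_le_size.
Qed.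

(** * Cumulative sums of the weights *)

Definition Fcum (M : nat) : nat := (\sum_(i < M.+1) Fnorm i%:Z)%N.

Lemma Fcum0 : Fcum 0 = 0%N.
Proof. by rewrite /Fcum big_ord1 Fnorm0. Qed.

Lemma FcumS M : Fcum M.+1 = (Fcum M + Fnorm M.+1%:Z)%N.
Proof. by rewrite /Fcum big_ord_recr. Qed.

Lemma sum_Fnorm M :
  (\sum_(0 <= i < 2 * M + 1) Fnorm (i%:Z - M%:Z))%N = (2 * Fcum M)%N.
Proof.
elim: M => [|M IH]; first by rewrite big_nat1 Fcum0 subr0 Fnorm0.
have -> : (2 * M.+1 + 1 = (2 * M + 1).+2)%N by lia.
rewrite big_nat_recl // big_nat_recr //= FcumS.
have -> : 0%:Z - M.+1%:Z = - M.+1%:Z by lia.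
have -> : (2 * M + 1).+1%:Z - M.+1%:Z = M.+1%:Z by lia.
under eq_bigr => i _ do (have -> : i.+1%:Z - M.+1%:Z = i%:Z - M%:Z by lia).
by rewrite IH FnormN; lia.
Qed.

(** Raising [N] by one adds [1 + Fnorm (F_k - N - 1)] to the first sum and removes
    [Fnorm (F_k - N - 1)] from the second, so the total grows by exactly one. *)
Lemma Fcum_below k i : (hmax k + i < fibF k)%N ->
  (Fcum (hmax k + i) + Fcum (fibF k - (hmax k + i).+1) =
   Fcum (hmax k) + Fcum (hmax (k - 2)) + i)%N.
Proof.
have hF := fibF_hmax k; have hS := hmaxS k.
elim: i => [|i IH] ki; first by rewrite !addn0 hF; congr (_ + Fcum _)%N; lia.
have -> : (hmax k + i.+1 = (hmax k + i).+1)%N by lia.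
rewrite FcumS (Fnorm_step k); last by lia.
rewrite -[X in Fnorm X]opprK FnormN.
have E : (fibF k - (hmax k + i).+1 = (fibF k - (hmax k + i).+2).+1)%N by lia.
have -> : - ((hmax k + i).+1%:Z - (fibF k)%:Z) = (fibF k - (hmax k + i).+2).+1%:Z by lia.
by have := IH (ltac:(lia)); rewrite E FcumS; lia.
Qed.

Lemma Fcum_above k i : (i <= hmax (k - 3))%N ->
  Fcum (fibF k + i) =
  (Fcum (hmax k) + Fcum (hmax (k - 2)) + (fibF k + i - hmax k) + Fcum i)%N.
Proof.
have hF := fibF_hmax k; have hS := hmaxS k.
elim: i => [|i IH] ki.
  have fk : Fnorm (fibF k)%:Z = 1%N.
    by rewrite (Fnorm_step k) ?subrr ?Fnorm0 //; lia.
  (* This choice of [i] reaches [F_k - 1], where the second sum is empty of weight. *)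
  have := Fcum_below k (hmax (k - 2)) (ltac:(lia)).
  rewrite Fcum0 !addn0 [in X in _ -> Fcum X = _]hF FcumS -hF fk subnn Fcum0; lia.
rewrite addnS !FcumS IH; last by lia.
rewrite (Fnorm_step k); last by lia.
have -> : (fibF k + i).+1%:Z - (fibF k)%:Z = i.+1%:Z by lia.
by lia.
Qed.

Lemma Fcum_hmaxS k : (Fcum (hmax k.+1) + hmax k =
  Fcum (hmax k) + Fcum (hmax (k - 2)) + Fcum (hmax (k - 3)) + hmax k.+1)%N.
Proof.
have hF := fibF_hmax k.
by rewrite hmaxS Fcum_above //; lia.
Qed.

Lemma Fcum_small : [/\ Fcum 1 = 1, Fcum 2 = 2 & Fcum 3 = 3]%N.
Proof.
have := Fcum_hmaxS 0; have := Fcum_hmaxS 1; have := Fcum_hmaxS 2.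
by rewrite /hmax /= Fcum0 => ? ? ?; split; lia.
Qed.

(** The main part of the bound reproduces itself by [F_(k+4) = F_(k+3) + F_(k+1) + F_k]. Each step
    adds an error of at most [k + 1], absorbed by the subtracted linear term, which occurs three
    times in the hypotheses. *)
Lemma Fcum_hmax k :
  `|5 * (Fcum (hmax k))%:Z - k%:Z * (hmax k)%:Z| <= 3 * (fibF k)%:Z - k%:Z - 1.
Proof.
elim/ltn_ind: k => k IH.
(* This combination depends only on [j] modulo 4, because [F_(j+6) = 2 F_(j+4) + F_(j+3)]. It is
   [h_(j+4) - 2 h_(j+3) + h_(j+1) - 1], the part of the error free of the factor [k]. *)
have G j : - 2 <= - (hmax j.+3)%:Z + 2 * (hmax j.+1)%:Z + (hmax j)%:Z <= 0.
  elim/nat_ind4: j => // j; rewrite !hmax4.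
  by have := fibFSS j.+4; have := fibFSS j.+3; have := fibFSS j.+2; have := fibFSS j.+1; lia.
case: k IH => [|k] IH; first by rewrite Fcum0.
have := Fcum_hmaxS k.
case: k IH => [|[|[|k]]] IH.
1-3: by have [] := Fcum_small; rewrite /hmax /fibF /=; lia.
rewrite !subSS !subn0.
have := IH k.+3 (ltac:(lia)); have := IH k.+1 (ltac:(lia)); have := IH k (ltac:(lia)).
have := G k; have := hmax_add2 k; have := hmax_add2 k.+1; have := hmax_add2 k.+2.
have := hmax4 k; have := fibFSS k; have := fibFSS k.+1; have := fibFSS k.+2.
move: (hmax k.+4) => h4 *.
have h4E : h4 = (hmax k.+3 + hmax k.+1 + hmax k + 1)%N by lia.
by subst h4; lia.
Qed.

(** Above [hmax k] the sum is cut at [F_k], through [Fcum_above] or the complement in [Fcum_below].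
    The remainder is at most [hmax (k - 2)], so the index drops by three and [10 F] leaves room for
    the new errors. *)
Lemma Fcum_bound k M : (M <= hmax k)%N ->
  `|5 * (Fcum M)%:Z - k%:Z * M%:Z| <= 10 * (fibF k)%:Z.
Proof.
elim/ltn_ind: k M => -[|k] IH M Mk.
  by move: Mk; rewrite leqn0 => /eqP ->; rewrite Fcum0.
have hF := fibF_hmax k; have hS := hmaxS k.
have [Mh|hM] := leqP M (hmax k).
  have := IH k (leqnn _) M Mh.
  have : (3 * fibF k <= 2 * fibF k.+1)%N.
    case: k {IH Mk hF hS Mh} => [|[|k]] //.
    by have := fibFSS k; have := fibFSS k.+1; have := fibF_mono k; lia.
  by lia.
case: k => [|[|j]] in IH hF hS Mk hM *.
- have -> : M = 1%N by move: hM Mk; rewrite /hmax; lia.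
  by have [-> _ _] := Fcum_small.
- have -> : M = 2 by move: hM Mk; rewrite /hmax; lia.
  by have [_ -> _] := Fcum_small.
have Uk := Fcum_hmax j.+2; have Uj := Fcum_hmax j.
have jF : (j <= fibF j)%N by have := leq_hmax j; have := fibF_hmax j; lia.
have F2 := fibFSS j; have F3 := fibFSS j.+1; have F1 := fibF_mono j.
have sumk := hmax_add2 j.
rewrite !subSS subn0 in hF hS; have j1 : (hmax (j - 1) <= hmax j)%N by apply: hmax_mono; lia.
(* The relation [sumk] times [j], stated separately because [lia] treats these products as atoms. *)
have jE : j%:Z * (hmax j)%:Z + j%:Z * (hmax j.+2)%:Z + j%:Z = j%:Z * (fibF j.+2)%:Z.
  by rewrite -sumk; lia.
have [FM|MF] := leqP (fibF j.+2) M.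
  have A := Fcum_above j.+2 (M - fibF j.+2) (ltac:(rewrite !subSS; lia)).
  rewrite subnKC // !subSS subn0 in A.
  have := IH j (ltac:(lia)) (M - fibF j.+2)%N (ltac:(lia)).
  move: (M - _)%N (subnK FM) A => m mM ->; subst M.
  by lia.
have A := Fcum_below j.+2 (M - hmax j.+2) (ltac:(lia)).
rewrite subnKC ?(ltnW hM) // !subSS subn0 in A.
have := IH j (ltac:(lia)) (fibF j.+2 - M.+1)%N (ltac:(lia)).
have mE : j%:Z * (fibF j.+2 - M.+1)%N%:Z + j%:Z * M%:Z + j%:Z = j%:Z * (fibF j.+2)%:Z.
  by rewrite -[in RHS](subnK MF); lia.
by lia.
Qed.

Lemma hmax_interval M : (0 < M)%N -> exists k, (hmax k < M <= hmax k.+1)%N.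
Proof.
move=> M0; have Mex : exists k, (M <= hmax k)%N by exists M; apply: leq_hmax.
case: (ex_minnP Mex) => -[|k] Mk kmin; first by rewrite leqNgt M0 in Mk.
by exists k; rewrite Mk andbT ltnNge; apply/negP => /kmin; rewrite ltnn.
Qed.

(** * Golden ratio and logarithmic estimates *)

Lemma golden_sqr (R : rcfType) (phi := (1 + Num.sqrt 5) / 2 : R) :
  2 < phi ^+ 2 /\ phi ^+ 2 = phi + 1.
Proof.
have s5 : Num.sqrt 5 ^+ 2 = 5 :> R by rewrite sqr_sqrtr.
have s0 : 0 <= Num.sqrt 5 :> R by apply: sqrtr_ge0.
have s1 : 1 < Num.sqrt 5 :> R by rewrite -[X in X < _]sqrtr1 ltr_sqrt // ltr1n.
by rewrite /phi; split; [nra | field: s5].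
Qed.

Lemma fibF_golden (R : rcfType) k (phi := (1 + Num.sqrt 5) / 2 : R) :
  phi ^+ k <= (fibF k)%:R <= phi ^+ k.+1.
Proof.
have [phi2 phiE] := golden_sqr R; rewrite -/phi in phi2 phiE.
have phi1 : 1 <= phi by lra.
have phi2' : phi <= 2 by nra.
elim/ltn_ind: k => -[|[|k]] IH.
- by rewrite expr0 expr1 lexx.
- by rewrite expr1 phi2' ltW.
have /andP[l0 u0] := IH k (ltac:(lia)); have /andP[l1 u1] := IH k.+1 (ltac:(lia)).
have E j : phi ^+ j.+2 = phi ^+ j.+1 + phi ^+ j.
  by rewrite -addn2 exprD phiE mulrDr mulr1 -exprSr.
by rewrite fibFSS natrD (E k) (E k.+1) !lerD.
Qed.

Lemma average_bound (R : realType) M (phi := (1 + Num.sqrt 5) / 2 : R) : (0 < M)%N ->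
  `|(2 * M + 1)%:R^-1 * (2 * Fcum M)%:R - 5^-1 * (ln M%:R / ln phi)| <= 100.
Proof.
move=> M0; have [k /andP[kM Mk]] := hmax_interval M M0.
have [phi2 phiE] := golden_sqr R; rewrite -/phi in phi2 phiE.
have phi1 : 1 < phi by lra.
have lnphi : 0 < ln phi by rewrite ln_gt0.
have kltM : (k < M)%N by apply: leq_ltn_trans (leq_hmax k) kM.
have hF := fibF_hmax k; have hF1 := fibF_hmax k.+1.
have h2 : (hmax (k - 2) <= hmax k)%N by apply: hmax_mono; lia.
have F1 : (fibF k.+1 <= 2 * fibF k)%N.
  by case: k {kM Mk kltM hF hF1 h2} => // k; rewrite fibFSS; have := fibF_mono k; lia.
set L := ln M%:R / ln phi.
have /andP[lk _] := fibF_golden R k; have /andP[_ uk] := fibF_golden R k.+1.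
rewrite -/phi in lk uk.
have MR : 0 < M%:R :> R by rewrite ltr0n.
have phi0 : 0 < phi by lra.
have lnX n : ln (phi ^+ n) = n%:R * ln phi by rewrite lnXn // mulr_natl.
have L1 : L <= k.+2%:R.
  rewrite /L ler_pdivrMr // -lnX ler_ln ?posrE ?exprn_gt0 //.
  by apply: le_trans uk; rewrite ler_nat; lia.
(* From [phi^k <= F_k <= 2 M] and [2 < phi^2]. *)
have L2 : k%:R <= L + 2.
  rewrite -lerBlDr /L ler_pdivlMr // mulrBl lerBlDr -(lnX 2) -lnX.
  rewrite -lnM ?posrE ?exprn_gt0 // ler_ln ?posrE ?mulr_gt0 ?exprn_gt0 //.
  apply: le_trans lk _; apply: (@le_trans _ _ (M%:R * 2)).
    by rewrite -natrM ler_nat; lia.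
  by rewrite ler_pM2l // ltW.
(* The constant 40 comes from [10 F_(k+1) <= 20 F_k <= 40 M]. *)
have [V1 V2] : (5 * Fcum M <= k.+1 * M + 40 * M)%N /\ (k.+1 * M <= 5 * Fcum M + 40 * M)%N.
  by have := Fcum_bound k.+1 M Mk; lia.
rewrite -(ler_nat R) !natrD !natrM in V1; rewrite -(ler_nat R) !natrD !natrM in V2.
(* Replacing [2 M] by the denominator [2 M + 1] costs [k + 1], which must stay of order [M]. *)
have kR : k%:R <= M%:R :> R by rewrite ler_nat ltnW.
have -> : (2 * M + 1)%:R^-1 * (2 * Fcum M)%:R = (2 * (Fcum M)%:R) / (2 * M%:R + 1) :> R.
  by rewrite mulrC natrM natrD natrM.
have D0 : 0 < 2 * M%:R + 1 :> R by lra.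
set a := _ / _; have aE : a * (2 * M%:R + 1) = 2 * (Fcum M)%:R by rewrite divfK ?gt_eqF.
rewrite -natr1 in V1 V2 L1; rewrite -natr1 in L1.
have k0 : 0 <= k%:R :> R by [].
have a1 : 5 * a - (k%:R + 1) <= 81.
  by rewrite -(ler_pM2r D0); nra.
have a2 : - 81 <= 5 * a - (k%:R + 1).
  by rewrite -(ler_pM2r D0); nra.
rewrite ler_norml; apply/andP; split; lra.
Qed.

Theorem mainTheorem11 (R : realType) :
  (fun M : nat =>
     (2 * M + 1)%:R^-1 * \sum_(0 <= i < 2 * M + 1) (Fnorm (i%:Z - M%:Z))%:R : R)
  = (fun M : nat => 5^-1 * (ln M%:R / ln ((1 + Num.sqrt 5) / 2)) : R)
    +O_\oo (fun _ : nat => 1 : R).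
Proof.
apply/eqaddOP; near=> C; near=> M.
rewrite !fctE -natr_sum sum_Fnorm normr1 mulr1.
apply: (@le_trans _ _ 100); last by near: C; apply: nbhs_pinfty_ge.
by apply: average_bound; near: M; exists 1%N.
Unshelve. all: by end_near.
Qed.
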